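(* In the $q$-Poisson $W$-algebra of type $A_{2N}^{(2)}$, the currents $T_i^{\mathrm{PB}}(z)$ satisfy the duality relations $$T_{2N+1-i}^{\mathrm{PB}}(z)=T_i^{\mathrm{PB}}(z),\qquad 0\le i\le N.$$
   Context: Parameters: $N\ge 1$ is an integer, $r>1$ is real, $x\in\mathbb C$ with $0<|x|<1$. Powers of $x$ are taken with a fixed choice of $\log x$, and $[a]_x=\frac{x^a-x^{-a}}{x-x^{-1}}$ for real $a$. Put $\Delta(z)=\frac{(1-x^{2r-1}z)(1-x^{-2r+1}z)}{(1-xz)(1-x^{-1}z)}$. Heisenberg algebra: $B(m)=(B_{i,j}(m))_{i,j=1}^N$ is the symmetric matrix with, for $m\ne0$, $B_{i,i}(m)=\frac{[2m]_x}{[m]_x}$ for $1\le i\le N-1$, $B_{N,N}(m)=\frac{[2m]_x-[m]_x}{[m]_x}$, $B_{i,j}(m)=-1$ if $|i-j|=1$, $B_{i,j}(m)=0$ if $|i-j|\ge2$; and $B_{i,i}(0)=2$ for $i\le N-1$, $B_{N,N}(0)=1$, $B_{i,j}(0)=-1$ if $|i-j|=1$, $0$ if $|i-j|\ge2$. The generators $a_i(m)$ ($m\in\mathbb Z$, $1\le i\le N$) satisfy $[a_i(m),a_j(n)]=\tfrac1m[rm]_x[(r-1)m]_xB_{i,j}(m)(x-x^{-1})^2\delta_{m+n,0}$ for $m,n\neq0$, and $a_i(0)$ commutes with all $a_j(m)$. Let $y_i(m)=\sum_j(B(m)^{-1})_{i,j}a_j(m)$. Normal ordering ${:}\ {:}$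 moves all $a_i(m)$ with $m\ge0$ to the right of those with $m<0$; inside it the inverse of an exponential is obtained by changing the sign of the exponent. Put $A_i(z)=x^{ra_i(0)}{:}\exp(\sum_{m\neq0}a_i(m)z^{-m}){:}$, $Y_i(z)=x^{ry_i(0)}{:}\exp(\sum_{m\ne0}y_i(m)z^{-m}){:}$. Index set: $J_N=\{1,\dots,N,0,\overline N,\dots,\overline1\}$, ordered $1\prec\cdots\prec N\prec0\prec\overline N\prec\cdots\prec\overline1$, $\overline{\overline k}=k$, $\overline0=0$. Set $\Lambda_1(z)=Y_1(z)$; $\Lambda_k(z)={:}\Lambda_{k-1}(z)A_{k-1}(x^{-k+1}z)^{-1}{:}$ ($2\le k\le N$); $\Lambda_0(z)=\frac{[r-\frac12]_x}{[\frac12]_x}{:}\Lambda_N(z)A_N(x^{-N}z)^{-1}{:}$; $\Lambda_{\overline N}(z)=\frac{[\frac12]_x}{[r-\frac12]_x}{:}\Lambda_0(z)A_N(x^{-N-1}z)^{-1}{:}$; $\Lambda_{\overline k}(z)={:}\Lambda_{\overline{k+1}}(z)A_k(x^{-2N+k-1}z)^{-1}{:}$ ($1\le k\le N-1$). For $\Omega=\{s_1\prec\cdots\prec s_i\}\subset J_N$ set $d_\Omega(x,r)=\prod_{1\le p<p'\le i,\ s_{p'}=\overline{s_p}}\Delta(x^{2(p'-p+s_p-N-1)})$ and $\overrightarrow\Lambda_\Omega(z)={:}\Lambda_{s_1}(x^{-i+1}z)\Lambda_{s_2}(x^{-i+3}z)\cdots\Lambda_{s_i}(x^{i-1}z){:}$.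 Then $T_0(z)=1$ and $T_i(z)=\sum_{|\Omega|=i}d_\Omega(x,r)\overrightarrow\Lambda_\Omega(z)$, $1\le i\le2N+1$; write $T_i(z)=\sum_{m\in\mathbb Z}T_i[m]z^{-m}$. Classical limit: set $q=x^{r}$ and $\beta=(r-1)/r$ (so $x=q^{1-\beta}$, $r=1/(1-\beta)$), and let $\beta\to0$ with $q$ fixed. Then $T_i(z)\to T_i^{\mathrm{PB}}(z)=\sum_mT_i^{\mathrm{PB}}[m]z^{-m}$. Concretely, in the limit the $a_i(m)$ become commuting variables, and $T_i^{\mathrm{PB}}(z)$ is obtained by setting $x=q$, $r=1$ (where $\Delta=1$ and $[r-\frac12]_x/[\frac12]_x=1$) with commuting variables, namely: with $y_i(m)=\sum_j\big((B(m)|_{x=q})^{-1}\big)_{i,j}a_j(m)$, $A_i^{\mathrm{PB}}(z)=q^{a_i(0)}\exp(\sum_{m\neq0}a_i(m)z^{-m})$ and $Y_i^{\mathrm{PB}}(z)=q^{y_i(0)}\exp(\sum_{m\neq0}y_i(m)z^{-m})$, put $\Lambda_1^{\mathrm{PB}}(z)=Y_1^{\mathrm{PB}}(z)$; $\Lambda_k^{\mathrm{PB}}(z)=\Lambda_{k-1}^{\mathrm{PB}}(z)A_{k-1}^{\mathrm{PB}}(q^{-k+1}z)^{-1}$ ($2\le k\le N$); $\Lambda_0^{\mathrm{PB}}(z)=\Lambda_N^{\mathrm{PB}}(z)A_N^{\mathrm{PB}}(q^{-N}z)^{-1}$; $\Lambda_{\overline N}^{\mathrm{PB}}(z)=\Lambda_0^{\mathrm{PB}}(z)A_N^{\mathrm{PB}}(q^{-N-1}z)^{-1}$;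 $\Lambda_{\overline k}^{\mathrm{PB}}(z)=\Lambda_{\overline{k+1}}^{\mathrm{PB}}(z)A_k^{\mathrm{PB}}(q^{-2N+k-1}z)^{-1}$ ($1\le k\le N-1$); then $T_0^{\mathrm{PB}}(z)=1$ and $$T_i^{\mathrm{PB}}(z)=\sum_{\{s_1\prec\cdots\prec s_i\}\subset J_N}\Lambda_{s_1}^{\mathrm{PB}}(q^{-i+1}z)\Lambda_{s_2}^{\mathrm{PB}}(q^{-i+3}z)\cdots\Lambda_{s_i}^{\mathrm{PB}}(q^{i-1}z),\qquad 1\le i\le 2N+1.$$ *)

(* Defs.v *)
From HB Require Import structures.
From mathcomp Require Import all_boot all_order all_algebra.
From mathcomp Require Import finmap multiset complex.
From mathcomp Require Import all_classical all_reals all_analysis.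

Set Implicit Arguments.
Unset Strict Implicit.
Unset Printing Implicit Defensive.

Import Order.TTheory GRing.Theory Num.Theory.

Local Open Scope ring_scope.

(* Formal power series over K in a possibly infinite set V of commuting
   variables.  A monomial is a finite multiset of variables, and f mu is the
   coefficient of the monomial mu in f. *)
Definition fps (V : choiceType) (K : Type) : Type := {mset V}%mset -> K.

HB.instance Definition _ (V : choiceType) (K : Type) := gen_eqMixin (fps V K).
HB.instance Definition _ (V : choiceType) (K : Type) :=
  gen_choiceMixin (fps V K).

Section MonomialDivisors.
Local Open Scope mset_scope.
Variable V : choiceType.
Implicit Types (mu al be : {mset V}).

Definition divs mu : {fset {mset V}} :=
  [fset seq_mset (mask (val b) mu) | b in {: (size mu).-tuple bool}]%fset.

Lemma mem_divs mu al : (al \in divs mu) = (al `<=` mu)%mset.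
Proof.
apply/idP/idP.
  case/imfsetP=> b _ ->; apply/msubsetP=> x; rewrite mset_seqE -count_mem_mset.
  exact/leq_count_subseq/mask_subseq.
move/msubsetP=> le_al.
have /count_subseqP [s /subseqP[b szb ->] al_s] :
    forall x, (count_mem x al <= count_mem x mu)%N.
  by move=> x; rewrite !count_mem_mset.
have sz : size b == size mu by rewrite szb.
apply/imfsetP; exists (Tuple sz); first by [].
by rewrite -[LHS]seq_mset_id; apply/eq_seq_msetP.
Qed.

Lemma perm_divs_sub mu al : (al `<=` mu)%mset ->
  perm_eq (divs al) [seq be <- divs mu | (be `<=` al)%mset].
Proof.
move=> le_al; apply: uniq_perm; rewrite ?filter_uniq ?fset_uniq//.
move=> be; rewrite mem_filter !mem_divs.
by case: (boolP (be `<=` al)%mset) => //= /msubset_trans ->.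
Qed.

Lemma perm_divs_above mu al : (al `<=` mu)%mset ->
  perm_eq [seq be <- divs mu | (al `<=` be)%mset]
          [seq al `+` be | be <- divs (mu `\` al)].
Proof.
move=> le_al; apply: uniq_perm.
- by rewrite filter_uniq ?fset_uniq.
- by rewrite map_inj_uniq ?fset_uniq//; apply: can_inj (msetDKB al).
move=> be; rewrite mem_filter mem_divs; apply/andP/mapP.
  case=> le1 le2; exists (be `\` al); last by rewrite msetBDKC.
  by rewrite mem_divs msetSB.
case=> ga; rewrite mem_divs => lega ->; split.
  by apply/msubsetP=> x; rewrite msetE2 leq_addr.
by rewrite -(msetBDKC le_al); apply: msetDS.
Qed.

Lemma perm_divs_compl mu :
  perm_eq (divs mu) [seq mu `\` al | al <- divs mu].
Proof.
apply: uniq_perm; first exact: fset_uniq.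
  rewrite map_inj_in_uniq ?fset_uniq// => a b.
  by rewrite !mem_divs => /msetBBK {2}<- /msetBBK {2}<- ->.
move=> be; rewrite mem_divs; apply/idP/mapP.
  by move=> le; exists (mu `\` be); rewrite ?mem_divs ?msubsetDl ?msetBBK.
by case=> al _ ->; apply: msubsetDl.
Qed.

End MonomialDivisors.

Section FpsRing.
Local Open Scope mset_scope.
Variables (V : choiceType) (K : comNzRingType).
Implicit Types (f g h : fps V K).

Definition fps_zero : fps V K := fun=> 0.
Definition fps_opp f : fps V K := fun mu => - f mu.
Definition fps_add f g : fps V K := fun mu => f mu + g mu.

Fact fps_addA : associative fps_add.
Proof. by move=> f g h; apply/funext => mu; apply: addrA. Qed.
Fact fps_addC : commutative fps_add.
Proof. by move=> f g; apply/funext => mu; apply: addrC. Qed.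
Fact fps_add0 : left_id fps_zero fps_add.
Proof. by move=> f; apply/funext => mu; apply: add0r. Qed.
Fact fps_addN : left_inverse fps_zero fps_opp fps_add.
Proof. by move=> f; apply/funext => mu; apply: addNr. Qed.

HB.instance Definition _ := GRing.isZmodule.Build (fps V K)
  fps_addA fps_addC fps_add0 fps_addN.

Definition fps_one : fps V K := fun mu => (mu == mset0)%:R.
Definition fps_mul f g : fps V K :=
  fun mu => \sum_(al <- divs mu) f al * g (mu `\` al).

Fact fps_mulC : commutative fps_mul.
Proof.
move=> f g; apply/funext => mu; rewrite /fps_mul.
rewrite (perm_big _ (perm_divs_compl mu)) big_map /=.
rewrite !big_seq; apply: eq_bigr => al; rewrite mem_divs => le_al.
by rewrite msetBBK// mulrC.
Qed.

Fact fps_mulA : associative fps_mul.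
Proof.
move=> f g h; apply/funext => mu; rewrite /fps_mul; symmetry.
under eq_bigr => ga _ do rewrite big_distrl /=.
transitivity (\sum_(ga <- divs mu) \sum_(al <- divs mu | al `<=` ga)
    f al * g (ga `\` al) * h (mu `\` ga)).
  rewrite !big_seq; apply: eq_bigr => ga; rewrite mem_divs => le_ga.
  by rewrite (perm_big _ (perm_divs_sub le_ga)) /= big_filter.
rewrite (exchange_big_dep xpredT) //=.
rewrite !big_seq; apply: eq_bigr => al; rewrite mem_divs => le_al.
rewrite -big_filter (perm_big _ (perm_divs_above le_al)) big_map big_distrr /=.
by apply: eq_bigr => be _; rewrite msetDKB msetBDA mulrA.
Qed.

Fact fps_mul1 : left_id fps_one fps_mul.
Proof.
move=> f; apply/funext => mu; rewrite /fps_mul.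
rewrite (bigD1_seq mset0) ?mem_divs ?msub0set ?fset_uniq//=.
rewrite /fps_one eqxx mul1r msetB0 big1 ?addr0// => al /negPf ->.
by rewrite mul0r.
Qed.

Fact fps_mulDl : left_distributive fps_mul fps_add.
Proof.
move=> f g h; apply/funext => mu; rewrite /fps_mul /fps_add -big_split /=.
by apply: eq_bigr => al _; rewrite mulrDl.
Qed.

Fact fps_one_neq0 : fps_one != 0.
Proof.
apply/eqP => /(congr1 (fun f : fps V K => f mset0)).
by rewrite /fps_one eqxx => /eqP; rewrite oner_eq0.
Qed.

HB.instance Definition _ := GRing.Zmodule_isComNzRing.Build (fps V K)
  fps_mulA fps_mulC fps_mul1 fps_mulDl fps_one_neq0.

Definition fps_unit : pred (fps V K) := fun f => `[< exists g, g * f = 1 >].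
Definition fps_inv f : fps V K :=
  if pselect (exists g, g * f = 1) is left ex then projT1 (cid ex) else f.

Fact fps_mulV : {in fps_unit, left_inverse 1 fps_inv *%R}.
Proof.
move=> f /asboolP ex; rewrite /fps_inv.
by case: pselect => // ex'; case: (cid ex').
Qed.
Fact fps_unitP f g : g * f = 1 -> fps_unit f.
Proof. by move=> gf; apply/asboolP; exists g. Qed.
Fact fps_inv_out : {in [predC fps_unit], fps_inv =1 id}.
Proof.
move=> f /negP nu; rewrite /fps_inv; case: pselect => // ex.
by case: nu; apply/asboolP.
Qed.

HB.instance Definition _ := GRing.ComNzRing_hasMulInverse.Build (fps V K)
  fps_mulV fps_unitP fps_inv_out.

(* The (possibly infinite) linear combination of the variables in which the
   variable v has coefficient c v. *)
Definition fps_lin (c : V -> K) : fps V K :=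
  fun mu => \sum_(v <- finsupp mu | mu == [mset v]) c v.

End FpsRing.

(* exp f = sum_k f^k / k!, for f without constant term: only the f^k with
   k <= size mu can contribute to the coefficient of mu. *)
Definition fps_exp (V : choiceType) (K : fieldType) (f : fps V K) : fps V K :=
  fun mu => \sum_(k < (size mu).+1) (f ^+ k) mu / k`!%:R.

Definition cexp (R : realType) (c : R[i]) : R[i] :=
  (expR (complex.Re c) * cos (complex.Im c)
    +i* (expR (complex.Re c) * sin (complex.Im c)))%C.

Section Currents.
(* The rank is N = n.+1; ordinals i : 'I_N stand for the labels i.+1.
   logq is the chosen logarithm of q, used in q^{a_i(0)}. *)
Variables (R : realType) (n : nat) (q logq : R[i]).
Local Notation N := n.+1.

(* Series in the variables a_j(m), (j, m) : 'I_N * int, with coefficients in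
   C(z).  A two-sided sum such as sum_(m != 0) a_j(m) z^(-m) makes sense here,
   since each variable occurs in one term only. *)
Definition ratz : fieldType := {fraction {poly R[i]}}.
Definition czconst (c : R[i]) : ratz := tofrac c%:P.
Definition zvar : ratz := tofrac 'X.
Definition current_ring := fps ('I_N * int)%type ratz.

Definition qnum (m : int) : R[i] := (q ^ m - q ^ (- m)) / (q - q^-1).

Definition Bmx (m : int) : 'M[R[i]]_N := \matrix_(i, j)
  if i == j then
    if m == 0 then (if i.+1 == N then 1 else 2)
    else if i.+1 == N then (qnum (2 * m) - qnum m) / qnum m
    else qnum (2 * m) / qnum m
  else if (i.+1 == j) || (j.+1 == i) then -1 else 0.

(* q^{b(0)} exp (sum_(m != 0) b(m) w^(-m)) for b(m) = sum_j e m j * a_j(m),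
   where q^{b(0)} = exp (b(0) log q). *)
Definition vertex (e : int -> 'I_N -> R[i]) (w : ratz) : current_ring :=
  fps_exp (fps_lin (fun v : 'I_N * int =>
    if v.2 == 0 then czconst (e v.2 v.1 * logq) else 0)) *
  fps_exp (fps_lin (fun v : 'I_N * int =>
    if v.2 != 0 then czconst (e v.2 v.1) * w ^ (- v.2) else 0)).

Definition A_PB (i : 'I_N) : ratz -> current_ring :=
  vertex (fun _ j => (j == i)%:R).
Definition Y_PB (i : 'I_N) : ratz -> current_ring :=
  vertex (fun m j => invmx (Bmx m) i j).

(* The ordinal of the label k, 1 <= k <= N. *)
Definition lab (k : nat) : 'I_N := inord k.-1.

(* Lambda_k for k = 1, ..., N is Lam_pos k (the value at 0 is not used). *)
Fixpoint Lam_pos (k : nat) (w : ratz) : current_ring :=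
  match k with
  | k'.+1 => if k' == 0%N then Y_PB (lab 1) w
             else Lam_pos k' w * (A_PB (lab k') (czconst (q ^ (- k'%:Z)) * w))^-1
  | 0 => 1
  end.

Definition Lam_zero (w : ratz) : current_ring :=
  Lam_pos N w * (A_PB (lab N) (czconst (q ^ (- N%:Z)) * w))^-1.

(* Lambda_{bar k} for k = N - d, by recursion on d. *)
Fixpoint Lam_bar_rec (d : nat) (w : ratz) : current_ring :=
  match d with
  | 0 => Lam_zero w * (A_PB (lab N) (czconst (q ^ (- N%:Z - 1)) * w))^-1
  | d'.+1 => let k := (N - d)%N in
      Lam_bar_rec d' w *
      (A_PB (lab k) (czconst (q ^ (- 2 * N%:Z + k%:Z - 1)) * w))^-1
  end.
Definition Lam_bar (k : nat) : ratz -> current_ring := Lam_bar_rec (N - k).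

(* J_N is encoded by positions in 1 < ... < N < 0 < bar N < ... < bar 1:
   k is at position k - 1, 0 at position N, bar k at position 2N + 1 - k. *)
Definition Lam (s : 'I_(2 * N).+1) (w : ratz) : current_ring :=
  if (s < N)%N then Lam_pos s.+1 w
  else if s == N :> nat then Lam_zero w
  else Lam_bar (2 * N + 1 - s) w.

(* enum Om lists Om increasingly, as s_1 < ... < s_i; here p counts from 0.
   For i = 0 the sum is 1. *)
Definition T_PB (i : nat) (w : ratz) : current_ring :=
  \sum_(Om : {set 'I_(2 * N).+1} | #|Om| == i)
    \prod_(p < i) Lam (nth ord0 (enum Om) p)
                      (czconst (q ^ (2 * p%:Z - i%:Z + 1)) * w).

End Currents.

Arguments zvar {R}.
Arguments T_PB {R} n q logq i w.

(* Main.v *)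
Require Import Defs.
From mathcomp Require Import all_boot all_order all_algebra.
From mathcomp Require Import finmap multiset complex ring zify.
From mathcomp Require Import all_classical all_reals all_analysis.

Import Order.TTheory GRing.Theory Num.Theory.
Local Open Scope ring_scope.

(** Write M = 2N + 1 and fold the labels of the nodes by U_c = Y_min(c, M - c),
    0 <= c <= M, with U_0 = U_M = 1, so that U_(M - c) = U_c.  Since A_i is
    obtained from the Y_j by the matrix B, the folding turns all nodes,
    including the special last one, into the same relation
      A(w) U_(c-1)(w) U_(c+1)(w) = U_c(q w) U_c(q^-1 w),   0 < c < M,
    where A = A_min(c, M - c): this is lemma [A_PB_folded_Y].  Hence the letter
    at position s of the ordered alphabet J_N, with s counted from 0, is for
    every s the ratio
      Lambda_s(w) = U_(s+1)(q^(-s) w) / U_s(q^(-s-1) w),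
    which is lemma [Lam_letter].

    The duality then holds term by term: the term of a set Omega of i letters in
    T_i equals the term in T_(M-i) of the reversed complement of Omega.  With
    h(s) the number of elements of Omega below s, and with
    V_s = U_s(q^(2 h(s) - i - s) z), the letter s of Omega contributes exactly
    V_(s+1) / V_s, because h grows by one there.  The product of V_(s+1) / V_s
    over all positions telescopes to V_M / V_0 = 1, so the term of Omega is the
    product of V_s / V_(s+1) over the s outside Omega.  There h stays constant,
    and by the symmetry of U the factor V_s / V_(s+1) is the letter M - 1 - s
    at the argument prescribed by the reversed complement.  This is lemma
    [letter_prod_rev_compl].

    Two facts support this.  Exponentials of linear forms in the variables
    a_j(m) turn sums into products ([fps_expD], [lin_expD]).  The matrix B(m) is
    invertible ([Bmx_unit]): a nonzero vector of its kernel would satisfy a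
    three-term recurrence whose boundary condition forces 1 + q^(m M) = 0, and
    0 < |q| < 1 excludes this. *)

Set Implicit Arguments.
Unset Strict Implicit.
Unset Printing Implicit Defensive.

(** * Telescoping products over sets and their reversed complements *)

Definition rank_in (n : nat) (Om : {set 'I_n}) (s : nat) : nat :=
  #|[set t in Om | (t < s)%N]|.

Lemma index_sorted_ltn (s : seq nat) x : sorted ltn s -> x \in s ->
  index x s = count (fun y => y < x)%N s.
Proof.
elim: s => //= y s IH sy; rewrite inE eq_sym; case: eqVneq => [<- _|ne] /=.
  rewrite ltnn add0n; symmetry; apply/eqP; rewrite eqn0Ngt -has_count.
  apply/hasPn => z zs; rewrite -leqNgt; apply: ltnW.
  exact: (allP (order_path_min ltn_trans sy)).
move=> xs; rewrite IH ?(path_sorted sy)//.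
by have /allP/(_ _ xs) /= -> := order_path_min ltn_trans sy.
Qed.

Lemma index_enum_set (n : nat) (Om : {set 'I_n}) (s : 'I_n) :
  s \in Om -> index s (enum Om) = rank_in Om s.
Proof.
move=> sOm; rewrite -(index_map val_inj) index_sorted_ltn; last 2 first.
- apply: (subseq_sorted ltn_trans) (iota_ltn_sorted 0 n).
  rewrite -val_enum_ord; apply/map_subseq.
  by rewrite enumT; apply: filter_subseq.
- by rewrite map_f ?mem_enum.
rewrite count_map /rank_in cardE -size_filter; apply/perm_size/uniq_perm.
- by rewrite filter_uniq ?enum_uniq.
- exact: enum_uniq.
by move=> t; rewrite mem_filter !mem_enum !inE andbC.
Qed.

(** Turns a product over ranks into a product over a set, where the rank of an
    element becomes a function that can be evaluated at any position. *)
Lemma prod_enum_rank (R : comNzRingType) (n : nat) (Om : {set 'I_n}) (x0 : 'I_n)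
    (F : 'I_n -> nat -> R) :
  \prod_(p < #|Om|) F (nth x0 (enum Om) p) p =
  \prod_(s in Om) F s (rank_in Om s).
Proof.
rewrite -[RHS]big_enum /= (big_nth x0) -cardE big_mkord; apply: eq_bigr => p _.
have pOm : (p < size (enum Om))%N by rewrite -cardE.
rewrite -index_enum_set ?index_uniq ?enum_uniq//.
by rewrite -mem_enum mem_nth.
Qed.

Lemma rank_inS (n : nat) (Om : {set 'I_n}) (s : 'I_n) :
  rank_in Om s.+1 = (rank_in Om s + (s \in Om))%N.
Proof.
rewrite /rank_in [LHS](cardsD1 s) inE ltnSn andbT addnC; congr (_ + _)%N.
apply: eq_card => t; rewrite !inE ltnS leq_eqVlt -val_eqE /=.
by case: eqVneq => [->|_] //=; rewrite ltnn andbF.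
Qed.

Lemma rank_in0 (n : nat) (Om : {set 'I_n}) : rank_in Om 0 = 0%N.
Proof.
by apply/eqP; rewrite cards_eq0; apply/eqP/setP => t; rewrite !inE andbF.
Qed.

(** In terms of the alphabet 1, ..., N, 0, bar N, ..., bar 1, reversing the
    positions is the bar involution. *)
Definition rev_compl (n : nat) (Om : {set 'I_n}) : {set 'I_n} :=
  [set s | rev_ord s \notin Om].

Lemma rev_complK (n : nat) : involutive (@rev_compl n).
Proof. by move=> Om; apply/setP => s; rewrite !inE negbK rev_ordK. Qed.

Lemma card_rev_compl (n : nat) (Om : {set 'I_n}) :
  #|rev_compl Om| = (n - #|Om|)%N.
Proof.
have /(congr1 (subn^~ #|Om|)) := cardsC Om; rewrite addKn card_ord => <-.
rewrite -(card_preimset (~: Om) rev_ord_inj).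
by apply: eq_card => s; rewrite !inE.
Qed.

Lemma rank_rev_compl (n : nat) (Om : {set 'I_n}) (s : nat) : (s <= n)%N ->
  (rank_in (rev_compl Om) (n - s) + #|Om| + s = n + rank_in Om s)%N.
Proof.
elim: s => [_|s IH sn].
  rewrite subn0 rank_in0 !addn0 /rank_in.
  have -> : [set t in rev_compl Om | (t < n)%N] = rev_compl Om.
    by apply/setP => t; rewrite inE ltn_ord andbT.
  by rewrite card_rev_compl subnK// (leq_trans (max_card _))// card_ord.
have := IH (ltnW sn); have := rank_inS Om (Ordinal sn).
have := rank_inS (rev_compl Om) (rev_ord (Ordinal sn)).
rewrite /= inE rev_ordK subnSK//; case: (_ \in Om) => /=; lia.
Qed.

(** The common form of all letters Lambda_s once U is a family of currents
    U s a = U_s(q^a w): the letter s at the argument q^a w. *)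
Definition letter (R : comUnitRingType) (U : nat -> int -> R) (s : nat)
    (a : int) : R :=
  U s.+1 (a - s%:Z) / U s (a - s%:Z - 1).

Lemma telescope_unit (R : comUnitRingType) (V : nat -> R) n :
  (forall s, V s \is a GRing.unit) ->
  \prod_(s < n) (V s.+1 / V s) = V n / V 0%N.
Proof.
move=> Vu; elim: n => [|n IH]; first by rewrite big_ord0 divrr.
by rewrite big_ord_recr IH /= mulrC mulrA divrK.
Qed.

(** The duality for a single term: the letters in Om and the inverses of those
    of its reversed complement are the factors of one telescoping product,
    whose end values U 0 and U n are both 1. *)
Lemma letter_prod_rev_compl (R : comUnitRingType) (n : nat)
    (U : nat -> int -> R)
    (Uu : forall s a, U s a \is a GRing.unit) (U0 : forall a, U 0%N a = 1)
    (Usym : forall s a, (s <= n)%N -> U (n - s)%N a = U s a)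
    (Om : {set 'I_n}) :
  \prod_(s in rev_compl Om)
     letter U s (2 * (rank_in (rev_compl Om) s)%:Z - #|rev_compl Om|%:Z + 1) =
  \prod_(s in Om) letter U s (2 * (rank_in Om s)%:Z - #|Om|%:Z + 1).
Proof.
(* The exponent of V moves by +1 along Om and by -1 outside of it, which is what
   makes both products below products of V s.+1 / V s or of its inverse. *)
pose V s := U s (2 * (rank_in Om s)%:Z - #|Om|%:Z - s%:Z).
have Vu s : V s \is a GRing.unit by apply: Uu.
have -> : \prod_(s in Om) letter U s (2 * (rank_in Om s)%:Z - #|Om|%:Z + 1) =
    \prod_(s in Om) (V s.+1 / V s).
  apply: eq_bigr => s sOm; rewrite /letter /V rank_inS sOm.
  by congr (U _ _ / U _ _); lia.
have -> : \prod_(s in rev_compl Om)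
     letter U s (2 * (rank_in (rev_compl Om) s)%:Z - #|rev_compl Om|%:Z + 1) =
    \prod_(s | s \notin Om) (V s.+1 / V s)^-1.
  rewrite (reindex_inj rev_ord_inj) /=.
  apply: eq_big => [s|s]; rewrite inE rev_ordK// => sOm.
  have rs : rank_in Om s.+1 = rank_in Om s.
    by rewrite rank_inS (negPf sOm) addn0.
  have argE : 2 * (rank_in (rev_compl Om) (n - s.+1))%:Z
      - #|rev_compl Om|%:Z + 1 - (n - s.+1)%N%:Z =
      2 * (rank_in Om s)%:Z - #|Om|%:Z - s%:Z.
    have := rank_rev_compl Om (ltn_ord s).
    have : (#|Om| <= n)%N by rewrite -[X in (_ <= X)%N]card_ord max_card.
    rewrite card_rev_compl rs; move: (ltn_ord s).
    by move: #|_| (rank_in _ _) (rank_in _ _) => k h h'; lia.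
  rewrite /letter /V /= argE rs invrM ?unitrV ?Uu// invrK subnSK//.
  rewrite !Usym//; last exact: ltnW.
  by congr (_ / U _ _); move: #|_| (rank_in _ _) => k h; lia.
have VV : \prod_(s < n) (V s.+1 / V s) = 1.
  by rewrite telescope_unit// /V -[n in U n]subn0 Usym// !U0 divr1.
rewrite (bigID (mem Om)) /= in VV.
apply: (@mulIr _ (\prod_(s | s \notin Om) (V s.+1 / V s))); last first.
  rewrite VV -big_split big1//= => s _.
  by rewrite mulVr// unitrM unitrV !Vu.
by rewrite rpred_prod// => s _; rewrite unitrM unitrV !Vu.
Qed.

Lemma letter_sum_duality (R : comUnitRingType) (n : nat) (U : nat -> int -> R)
    (Uu : forall s a, U s a \is a GRing.unit) (U0 : forall a, U 0%N a = 1)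
    (Usym : forall s a, (s <= n.+1)%N -> U (n.+1 - s)%N a = U s a) (i : nat) :
  (i <= n.+1)%N ->
  \sum_(Om : {set 'I_n.+1} | #|Om| == (n.+1 - i)%N)
    \prod_(p < n.+1 - i)
      letter U (nth ord0 (enum Om) p) (2 * p%:Z - (n.+1 - i)%N%:Z + 1) =
  \sum_(Om : {set 'I_n.+1} | #|Om| == i)
    \prod_(p < i) letter U (nth ord0 (enum Om) p) (2 * p%:Z - i%:Z + 1).
Proof.
move=> le_in.
have termE k (Om : {set 'I_n.+1}) : #|Om| == k ->
    \prod_(p < k) letter U (nth ord0 (enum Om) p) (2 * p%:Z - k%:Z + 1) =
    \prod_(s in Om) letter U s (2 * (rank_in Om s)%:Z - #|Om|%:Z + 1).
  move=> /eqP <-.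
  exact: (prod_enum_rank _ _
    (fun s p => letter U s (2 * p%:Z - #|Om|%:Z + 1))).
rewrite (eq_bigr _ (termE _)) [RHS](eq_bigr _ (termE _)).
rewrite (reindex_inj (inv_inj (@rev_complK _))) /=.
apply: eq_big => [Om|Om _]; last exact: letter_prod_rev_compl.
have : (#|Om| <= n.+1)%N by rewrite -[X in (_ <= X)%N]card_ord max_card.
by rewrite card_rev_compl; move: #|_| => k le_k; apply/eqP/eqP; lia.
Qed.

(** * Exponentials of linear forms in infinitely many variables *)

Lemma size_msetD (V : choiceType) (al be : {mset V}%mset) :
  size (al `+` be)%mset = (size al + size be)%N.
Proof.
rewrite -size_cat; apply: perm_size; apply/allP => x _ /=.
by rewrite count_cat !count_mem_mset msetE2.
Qed.

Lemma size_divs (V : choiceType) (mu al : {mset V}%mset) : al \in divs mu ->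
  size mu = (size al + size (mu `\` al)%mset)%N.
Proof. by rewrite mem_divs => le; rewrite -size_msetD msetBDKC. Qed.

Section Exponential.
Variables (V : choiceType) (K : fieldType).
Hypothesis K0 : [pchar K] =i pred0.
Implicit Types (f g : fps V K) (mu : {mset V}%mset).

Lemma fps_mulE f g mu :
  (f * g) mu = \sum_(al <- divs mu) f al * g (mu `\` al)%mset.
Proof. by []. Qed.

Lemma fps_sumE (I : Type) (r : seq I) (P : pred I) (F : I -> fps V K) mu :
  (\sum_(i <- r | P i) F i) mu = \sum_(i <- r | P i) F i mu.
Proof. exact: (big_morph (fun f : fps V K => f mu)). Qed.

Lemma fps_mulrnE f k mu : (f *+ k) mu = f mu *+ k.
Proof. by elim: k => // k IH; rewrite !mulrS -IH. Qed.

Lemma fps_expr_small f k mu :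
  f mset0 = 0 -> (size mu < k)%N -> (f ^+ k) mu = 0.
Proof.
move=> f0; elim: k mu => // k IH mu lt_k; rewrite exprS fps_mulE big_seq big1//.
move=> al al_mu; have [->|al0] := eqVneq al mset0; first by rewrite f0 mul0r.
rewrite IH ?mulr0// -ltnS (leq_trans _ lt_k)// ltnS (size_divs al_mu).
by rewrite -[X in (X < _)%N]add0n ltn_add2r lt0n size_mset_eq0.
Qed.

(** Lets the truncation bound be chosen uniformly for all divisors of a
    monomial, which is what comparing coefficients in a product needs. *)
Lemma fps_exp_widen f M mu : f mset0 = 0 -> (size mu <= M)%N ->
  fps_exp f mu = \sum_(k < M.+1) (f ^+ k) mu / k`!%:R.
Proof.
move=> f0 leM; rewrite /fps_exp.
rewrite (big_ord_widen M.+1 (fun k => (f ^+ k) mu / k`!%:R))//.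
rewrite [RHS](bigID (fun k : 'I_M.+1 => (k < (size mu).+1)%N)) /=.
rewrite [X in _ + X]big1 ?addr0//.
by move=> k; rewrite -leqNgt => lt_k; rewrite fps_expr_small ?mul0r.
Qed.

Lemma fact_neq0 k : k`!%:R != 0 :> K.
Proof. by rewrite ((pcharf0P K).1 K0) -lt0n fact_gt0. Qed.

(** The functional equation of exp, by comparing truncated double sums: on the
    left i + j is bounded by the size of the monomial, on the right i and j are
    bounded separately, and the terms in between vanish for lack of degree. *)
Lemma fps_expD f g : f mset0 = 0 -> g mset0 = 0 ->
  fps_exp (f + g) = fps_exp f * fps_exp g.
Proof.
move=> f0 g0; apply/funext => mu; set M := size mu.
pose c i j := (f ^+ i * g ^+ j) mu / (i`!%:R * j`!%:R).
have -> : (fps_exp f * fps_exp g) mu = \sum_(i < M.+1) \sum_(j < M.+1) c i j.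
  rewrite fps_mulE.
  under [RHS]eq_bigr => i _ do
    under eq_bigr => j _ do rewrite /c fps_mulE big_distrl.
  under [RHS]eq_bigr => i _ do rewrite exchange_big.
  rewrite [RHS]exchange_big /= !big_seq; apply: eq_bigr => al al_mu.
  have le_mu := size_divs al_mu.
  rewrite (@fps_exp_widen f M) ?(@fps_exp_widen g M) ?/M ?le_mu
    ?leq_addr ?leq_addl//.
  rewrite -le_mu big_distrl /=; apply: eq_bigr => i _.
  rewrite big_distrr /=; apply: eq_bigr => j _.
  by rewrite invfM mulrACA.
have -> : fps_exp (f + g) mu =
    \sum_(k < M.+1) \sum_(i < M.+1 | (i <= k)%N) c i (k - i)%N.
  apply: eq_bigr => k _; rewrite addrC exprDn fps_sumE big_distrl /=.
  rewrite (big_ord_widen M.+1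
     (fun i => (g ^+ (k - i) * f ^+ i *+ 'C(k, i)) mu / k`!%:R)) ?ltn_ord//.
  apply: eq_big => [i|i]; first by rewrite ltnS.
  rewrite ltnS => le_ik; rewrite fps_mulrnE /c [f ^+ i * _]mulrC.
  rewrite -[_ *+ 'C(k, i)]mulr_natr -(bin_fact le_ik) natrM.
  have Cn0 : 'C(k, i)%:R != 0 :> K by rewrite ((pcharf0P K).1 K0) -lt0n bin_gt0.
  by rewrite invfM -!mulrA (mulrA 'C(k, i)%:R) divff// mul1r natrM.
rewrite (exchange_big_dep xpredT) //=; apply: eq_bigr => i _.
rewrite [RHS](bigID (fun j : 'I_M.+1 => (i + j <= M)%N)) /=.
rewrite [X in _ = _ + X]big1 => [|j]; last first.
  rewrite -ltnNge => ltM; rewrite /c fps_mulE big_seq big1 ?mul0r// => al al_mu.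
  have {ltM} := ltM; rewrite {1}/M (size_divs al_mu).
  have [lt_i _|le_i lt_j] := ltnP (size (al : {mset V}%mset)) i.
    by rewrite fps_expr_small ?mul0r.
  rewrite [X in _ * X]fps_expr_small ?mulr0// -(ltn_add2l i).
  by rewrite (leq_trans _ lt_j)// ltnS leq_add2r.
rewrite addr0 -(big_geq_mkord i M.+1 xpredT (fun k => c i (k - i)%N)).
rewrite -{1}[nat_of_ord i]add0n big_addn big_mkord subSn; last by rewrite -ltnS.
rewrite (big_ord_widen M.+1 (fun j => c i (j + i - i)%N)) ?ltnS ?leq_subr//.
apply: eq_big => j; last by rewrite addnK.
by rewrite ltnS leq_subRL// -ltnS.
Qed.

Definition lin_exp (c : V -> K) : fps V K := fps_exp (fps_lin c).

Lemma fps_linD (a b : V -> K) :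
  fps_lin (fun v => a v + b v) = fps_lin a + fps_lin b.
Proof. by apply/funext => mu; rewrite /fps_lin big_split. Qed.

Lemma fps_lin_cst (a : V -> K) : fps_lin a mset0 = 0.
Proof.
by rewrite /fps_lin big1_seq// => v /andP[_]; rewrite mem_finsupp mset0E.
Qed.

Lemma lin_expD (a b : V -> K) :
  lin_exp (fun v => a v + b v) = lin_exp a * lin_exp b.
Proof. by rewrite /lin_exp fps_linD fps_expD ?fps_lin_cst. Qed.

Lemma lin_exp0 : lin_exp (fun=> 0) = 1.
Proof.
have l0 : fps_lin (fun=> 0) = 0 :> fps V K.
  by apply/funext => mu; rewrite /fps_lin big1.
apply/funext => mu; rewrite /lin_exp /fps_exp l0 big_ord_recl.
rewrite expr0 divr1 big1 ?addr0// => k _.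
by rewrite expr0n mul0r.
Qed.

Lemma lin_exp_unit (a : V -> K) : lin_exp a \is a GRing.unit.
Proof.
apply/unitrPr; exists (lin_exp (fun v => - a v)).
rewrite -lin_expD -[RHS]lin_exp0.
by congr lin_exp; apply/funext => v; rewrite subrr.
Qed.

Lemma lin_exp_mul_eq (c0 c1 c2 c3 c4 : V -> K) :
  (forall v, c0 v + (c1 v + c2 v) = c3 v + c4 v) ->
  lin_exp c0 * (lin_exp c1 * lin_exp c2) = lin_exp c3 * lin_exp c4.
Proof. by move=> e; rewrite -!lin_expD; congr lin_exp; apply/funext. Qed.

End Exponential.

(** * Invertibility of B(m) and its folding *)

(** The solutions of the recurrence are combinations of t^c and t^-c; with
    x 0 = 0 and the reflecting condition x N.+1 = x N they vanish unless
    t^(2N+1) = -1. *)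
Lemma three_term_zero (F : fieldType) (t : F) (x : nat -> F) (N : nat) :
  t != 0 -> 1 + t ^+ (2 * N).+1 != 0 -> x 0%N = 0 -> x N.+1 = x N ->
  (forall c, (c < N)%N -> x c.+2 = (t + t^-1) * x c.+1 - x c) ->
  forall c, (c <= N)%N -> x c = 0.
Proof.
move=> t0 tN x0 xN rec.
(* The two first-order recurrences obtained by factoring the characteristic
   polynomial; eliminating x N between them at c = N isolates x 1. *)
have up c : (c <= N)%N -> x c.+1 = t * x c + t ^- c * x 1%N.
  elim: c => [|c IH] lt_c; first by rewrite x0 expr0 invr1 mulr0 add0r mul1r.
  have -> : t ^- c.+1 * x 1%N = t^-1 * (t ^- c * x 1%N).
    by rewrite exprS invfM mulrA.
  have -> : t ^- c * x 1%N = x c.+1 - t * x c.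
    by rewrite (IH (ltnW lt_c)); ring.
  by rewrite rec//; field.
have dn c : (c <= N)%N -> x c.+1 = t^-1 * x c + t ^+ c * x 1%N.
  elim: c => [|c IH] lt_c; first by rewrite x0 mulr0 add0r mul1r.
  have -> : t ^+ c.+1 * x 1%N = t * (t ^+ c * x 1%N) by rewrite exprS mulrA.
  have -> : t ^+ c * x 1%N = x c.+1 - t^-1 * x c.
    by rewrite (IH (ltnW lt_c)); ring.
  by rewrite rec//; field.
have x1 : x 1%N = 0.
  apply: (mulfI tN); rewrite mulr0.
  have solve a b d : x N = a * x N + b * d -> b * d = x N - a * x N.
    by move=> e; rewrite [X in X - _]e addrC addKr.
  have e1 := up N (leqnn N); have e2 := dn N (leqnn N); rewrite xN in e1 e2.
  have e : (t ^- N + t ^+ N * t) * x 1%N = 0.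
    rewrite mulrDl [t ^+ N * t]mulrC -mulrA (solve _ _ _ e1) (solve _ _ _ e2).
    by field.
  rewrite -[RHS](mulr0 (t ^+ N)) -e exprSr mulnC exprM; field.
  by rewrite expf_neq0.
elim=> // c IH lt_c; rewrite up ?(ltnW lt_c)// IH ?(ltnW lt_c)// x1; ring.
Qed.

(** A column of X read along the folded diagram 1, ..., N, N, ..., 1 with a zero
    at both ends.  The repetition of N is what makes row N of B look like all
    the others. *)
Definition folded (K : nzRingType) (n p : nat) (X : 'M[K]_(n.+1, p)) (j : 'I_p)
    (c : nat) : K :=
  if (0 < c < (2 * n.+1).+1)%N
  then X (lab n (minn c ((2 * n.+1).+1 - c))) j else 0.

Lemma folded_sym (K : nzRingType) (n p : nat) (X : 'M[K]_(n.+1, p)) j c :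
  (c <= (2 * n.+1).+1)%N ->
  folded X j ((2 * n.+1).+1 - c) = folded X j c.
Proof.
move=> le_c; rewrite /folded subKn// minnC.
by congr (if _ then _ else _); apply/idP/idP; lia.
Qed.

Lemma sum_delta_ord (K : nzRingType) (n : nat) (f : 'I_n.+1 -> K) (c : nat) :
  \sum_(k < n.+1) (c == k)%:R * f k = if (c < n.+1)%N then f (inord c) else 0.
Proof.
case: ltnP => lt_c.
  rewrite (bigD1 (inord c)) //= inordK// eqxx mul1r big1 ?addr0// => k ne.
  case: eqP => [e|_]; last by rewrite mul0r.
  by case/eqP: ne; apply: val_inj; rewrite /= inordK.
rewrite big1// => k _; case: eqP => [e|_]; last by rewrite mul0r.
by move: (ltn_ord k); rewrite -e ltnNge lt_c.
Qed.

Section Matrix.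
Variables (R : realType) (n : nat) (q : R[i]).
Hypotheses (q0 : q != 0) (q1 : `|q| < 1).

Lemma normXz_eq1 (m : int) : `|q ^ m| = 1 -> m = 0.
Proof.
have natE k : `|q ^+ k| = 1 -> k = 0%N.
  case: k => // k; rewrite normrX => e.
  by have := exprn_ilt1 k.+1 (normr_ge0 q) q1; rewrite e ltxx.
case: m => k; first by move/natE => ->.
rewrite NegzE -exprnN normfV => /(congr1 (@GRing.inv _)).
by rewrite invrK invr1 => /natE.
Qed.

Lemma expz_neq1 (m : int) : m != 0 -> q ^ m != 1.
Proof. by apply: contraNneq => e; apply/eqP/normXz_eq1; rewrite e normr1. Qed.

Lemma qnum_num_neq0 (m : int) : m != 0 -> q ^ m - q ^ (- m) != 0.
Proof.
move=> m0; rewrite subr_eq0.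
apply: contraNneq (@expz_neq1 (m + m) _); last by lia.
by move=> e; rewrite expfzDr// {1}e -expfzDr// addNr.
Qed.

Lemma qnum2_div (m : int) :
  m != 0 -> qnum q (2 * m) / qnum q m = q ^ m + q ^ (- m).
Proof.
move=> m0; have := qnum_num_neq0 m0; have := qnum_num_neq0 (oner_neq0 int).
rewrite /qnum expr1z exprN1 => a b.
have -> : 2 * m = m + m by lia.
rewrite opprD !expfzDr//; move: a b.
move: (q ^ m) (q ^ (- m)) (q - q^-1) => x y d d0 xy.
by field; rewrite d0 xy.
Qed.

Lemma qnum_neq0 (m : int) : m != 0 -> qnum q m != 0.
Proof.
move=> m0; rewrite mulf_neq0 ?invr_eq0 ?qnum_num_neq0//.
exact: (qnum_num_neq0 (oner_neq0 int)).
Qed.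

(** The quotients of q-numbers defining B(m) all become q^m + q^-m, and this
    uniform form also covers m = 0. *)
Lemma BmxE (m : int) (i k : 'I_n.+1) :
  Bmx n q m i k = (i == k :> nat)%:R * (q ^ m + q ^ (- m) - (i.+1 == n.+1)%:R)
    - (i.+1 == k)%:R - (k.+1 == i)%:R.
Proof.
rewrite mxE -val_eqE /=; case: eqVneq => [e|ne].
  rewrite -e (_ : (i.+1 == i) = false) ?mul1r ?subr0; last by lia.
  have [->|m0] := eqVneq m 0.
    by rewrite oppr0 expr0z; case: ifP => _ /=; rewrite ?subr0// addrK.
  case: ifP => _ /=; last by rewrite subr0 qnum2_div.
  by rewrite mulrBl divff ?qnum_neq0// qnum2_div.
rewrite mul0r sub0r; case: (eqVneq i.+1 k) => [<-|_] /=.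
  by rewrite (_ : (i.+2 == i) = false) ?subr0; last by lia.
by case: eqP => //= _; rewrite ?subr0 ?oppr0 ?sub0r.
Qed.

Lemma Bmx_mulE (m : int) p (X : 'M[R[i]]_(n.+1, p)) (i : 'I_n.+1) j :
  (Bmx n q m *m X) i j =
  (q ^ m + q ^ (- m)) * folded X j i.+1 - folded X j i - folded X j i.+2.
Proof.
rewrite mxE; under eq_bigr => k _ do
  rewrite BmxE !mulrBl [_ * (_ - _)]mulrC -mulrA.
rewrite !sumrB -big_distrr /= !sum_delta_ord ltn_ord inord_val.
have -> : \sum_(k < n.+1) (k.+1 == i)%:R * X k j = folded X j i.
  have [i0|i0] := posnP i.
    by rewrite /folded i0 big1// => k _; rewrite mul0r.
  rewrite (eq_bigr (fun k : 'I_n.+1 => (i.-1 == k)%:R * X k j)) => [|k _];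
    last first.
    by rewrite -(eqSS i.-1) prednK// eq_sym.
  rewrite sum_delta_ord; have lt_i := ltn_ord i.
  rewrite /folded /lab i0 /= !ifT; [|by lia|by lia].
  by congr (X (inord _) j); lia.
have lt_i := ltn_ord i.
have -> : folded X j i.+1 = X i j.
  rewrite /folded /lab ifT; last by lia.
  by rewrite -[in RHS](inord_val i); congr (X (inord _) j); lia.
rewrite /folded /lab; have [lt_in|ge_in] := ltnP i.+1 n.+1.
  rewrite (_ : (0 < i.+2 < (2 * n.+1).+1)%N = true); last by lia.
  have -> : (i.+1 == n.+1) = false by lia.
  have -> : (minn i.+2 ((2 * n.+1).+1 - i.+2)).-1 = i.+1 by lia.
  by rewrite subr0; ring.
have e : i.+1 = n.+1 by lia.
rewrite e eqxx (_ : (0 < n.+2 < (2 * n.+1).+1)%N = true); last by lia.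
rewrite (_ : (minn n.+2 ((2 * n.+1).+1 - n.+2)).-1 = i); last by lia.
rewrite inord_val mulrBl mul1r subr0; ring.
Qed.

Lemma Bmx_sym (m : int) : (Bmx n q m)^T = Bmx n q m.
Proof.
apply/matrixP => i j; rewrite mxE !BmxE [j == i :> nat]eq_sym.
case: eqVneq => [->|_]; first by rewrite addrAC.
by rewrite !mul0r addrAC.
Qed.

Lemma Bmx_unit (m : int) : Bmx n q m \in unitmx.
Proof.
rewrite unitmxE unitfE; apply/det0P => -[v /eqP v0 vB]; case: v0.
pose x c := folded v^T ord0 c.
have rec c : (c < n.+1)%N -> x c.+2 = (q ^ m + (q ^ m)^-1) * x c.+1 - x c.
  move=> lt_c; have := congr1 trmx vB; rewrite trmx_mul Bmx_sym trmx0.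
  move/matrixP/(_ (Ordinal lt_c) ord0); rewrite Bmx_mulE !mxE /= -invr_expz.
  by move=> /subr0_eq e; rewrite /x -e.
have xz : forall c, (c <= n.+1)%N -> x c = 0.
  apply: (three_term_zero (t := q ^ m)) => //.
  - by rewrite expfz_neq0.
  - apply/negP; rewrite addrC addr_eq0 exprnP exprz_exp => /eqP qmN.
    have /normXz_eq1/eqP : `|q ^ (m * (2 * n.+1).+1)| = 1.
      by rewrite qmN normrN1.
    rewrite mulf_eq0 => /orP[/eqP m0|]; last by [].
    move: qmN; rewrite m0 mul0r expr0z => /eqP.
    by rewrite eq_sym eqNr oner_eq0.
  - by rewrite /x -[RHS]folded_sym; [congr folded; lia|lia].
apply/rowP => i; have := xz i.+1 (ltn_ord i).
rewrite /x /folded /lab ifT; last by have := ltn_ord i; lia.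
rewrite !mxE => <-; congr (v _ _).
apply: val_inj; rewrite /= inordK; have := ltn_ord i; lia.
Qed.

(** B(m) B(m)^-1 = 1 read along the folded diagram; positions beyond N follow
    from those up to N by symmetry. *)
Lemma folded_invmx (m : int) (j : 'I_n.+1) (c : nat) :
  (0 < c < (2 * n.+1).+1)%N ->
  let f := folded (invmx (Bmx n q m)) j in
  (q ^ m + q ^ (- m)) * f c - f c.-1 - f c.+1 =
  (lab n (minn c ((2 * n.+1).+1 - c)) == j)%:R.
Proof.
move=> /= c_in; set X := invmx _.
have main d : (0 < d <= n.+1)%N ->
    (q ^ m + q ^ (- m)) * folded X j d - folded X j d.-1 - folded X j d.+1 =
    (lab n d == j)%:R.
  case: d => // d lt_d; have := mulmxV (Bmx_unit m).
  move/matrixP/(_ (inord d) j); rewrite Bmx_mulE !mxE inordK//.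
have [le_c|lt_c] := leqP c n.+1.
  by rewrite main; [congr ((lab n _ == _)%:R); lia|lia].
have := main ((2 * n.+1).+1 - c)%N; rewrite !folded_sym; last by lia.
rewrite (_ : ((2 * n.+1).+1 - c).-1 = (2 * n.+1).+1 - c.+1)%N; last by lia.
rewrite (_ : ((2 * n.+1).+1 - c).+1 = (2 * n.+1).+1 - c.-1)%N; last by lia.
rewrite !folded_sym; [|lia|lia].
rewrite (minn_idPr _); last by lia.
by move=> <-; [ring|lia].
Qed.

End Matrix.

(** * The letters as ratios of folded currents *)

Lemma div_of_mulE (R : comUnitRingType) (a p r s t : R) :
  a \is a GRing.unit -> r \is a GRing.unit -> t \is a GRing.unit ->
  a * (t * p) = s * r -> p / r = s / t * a^-1.
Proof.
move=> ua ur ut e; apply: (canLR (mulrK ur)); rewrite -mulrA -invrM// mulrAC -e.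
by rewrite mulrA [_ * p]mulrC mulrK// unitrM ua ut.
Qed.

Section Vertex.
Variables (R : realType) (n : nat) (q logq : R[i]) (w : Defs.ratz R).
Hypotheses (q0 : q != 0) (q1 : `|q| < 1).

Lemma pchar_ratz : [pchar Defs.ratz R] =i pred0.
Proof.
apply/pcharf0P => k; rewrite -(rmorph_nat (@tofrac _)) tofrac_eq0.
by rewrite -(rmorph_nat (@polyC _)) polyC_eq0 pnatr_eq0.
Qed.

Lemma czconstM (a b : R[i]) : czconst (a * b) = czconst a * czconst b.
Proof. by rewrite /czconst polyCM rmorphM. Qed.

Lemma czconstD (a b : R[i]) : czconst (a + b) = czconst a + czconst b.
Proof. by rewrite /czconst polyCD rmorphD. Qed.

Lemma czconst0 : czconst (0 : R[i]) = 0.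
Proof. by rewrite /czconst rmorph0. Qed.

Lemma czconstX (a : R[i]) (m : int) : czconst (a ^ m) = czconst a ^ m.
Proof. exact: (fmorphXz (@tofrac _ \o @polyC R[i])). Qed.

Lemma czconst_shift (a b : int) :
  czconst (q ^ a) * (czconst (q ^ b) * w) = czconst (q ^ (b + a)) * w.
Proof. by rewrite mulrA -czconstM -expfzDr// addrC. Qed.

(** The zero mode and the other modes of a vertex involve different variables,
    so that both exponents merge into one linear form. *)
Definition vertex_coef (e : int -> 'I_n.+1 -> R[i]) (u : Defs.ratz R)
    (v : 'I_n.+1 * int) : Defs.ratz R :=
  if v.2 == 0 then czconst (e v.2 v.1 * logq)
  else czconst (e v.2 v.1) * u ^ (- v.2).

Lemma vertexE e u : vertex logq e u = lin_exp (vertex_coef e u).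
Proof.
rewrite /vertex -lin_expD; last exact: pchar_ratz.
congr lin_exp; apply/funext => v; rewrite /vertex_coef.
by case: eqP => _; rewrite ?addr0 ?add0r.
Qed.

(** The coefficients of the exponent of [folded_Y]: the rows of B(m)^-1 along the
    folded diagram. *)
Definition dual_coef (c : nat) (m : int) (j : 'I_n.+1) : R[i] :=
  folded (invmx (Bmx n q m)) j c.

(** Y_min(c, 2N+1-c)(q^a w) for 0 < c < 2N+1, and 1 for c = 0 and c = 2N+1. *)
Definition folded_Y (c : nat) (a : int) : current_ring R n :=
  vertex logq (dual_coef c) (czconst (q ^ a) * w).

Lemma folded_Y_unit c a : folded_Y c a \is a GRing.unit.
Proof. by rewrite /folded_Y vertexE; apply: lin_exp_unit pchar_ratz _. Qed.

Lemma folded_Y0 a : folded_Y 0 a = 1.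
Proof.
rewrite /folded_Y vertexE -[RHS]lin_exp0; congr lin_exp; apply/funext => v.
by rewrite /vertex_coef /dual_coef /folded /= mul0r czconst0 mul0r if_same.
Qed.

Lemma folded_Y_sym c a : (c <= (2 * n.+1).+1)%N ->
  folded_Y ((2 * n.+1).+1 - c) a = folded_Y c a.
Proof.
move=> le_c; rewrite /folded_Y.
have -> : dual_coef ((2 * n.+1).+1 - c) = dual_coef c; last by [].
apply/funext => m; apply/funext => j.
by rewrite /dual_coef folded_sym.
Qed.

(** In exponents this is [folded_invmx], the shifts of the argument by q and
    q^-1 producing the factor q^m + q^-m. *)
Lemma A_PB_folded_Y (c : nat) (a : int) : (0 < c < (2 * n.+1).+1)%N ->
  A_PB logq (lab n (minn c ((2 * n.+1).+1 - c))) (czconst (q ^ a) * w)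
    * (folded_Y c.-1 a * folded_Y c.+1 a) =
  folded_Y c (a + 1) * folded_Y c (a - 1).
Proof.
move=> c_in; rewrite /A_PB /folded_Y !vertexE.
apply: lin_exp_mul_eq; first exact: pchar_ratz.
case=> j m; rewrite /vertex_coef /dual_coef /=.
rewrite [j == _]eq_sym -(folded_invmx q0 q1 m j c_in) /=.
set X := folded _ j c; set X1 := folded _ j c.-1; set X2 := folded _ j c.+1.
have [->|m0] := eqVneq m 0.
  by rewrite oppr0 expr0z -!czconstD; congr czconst; ring.
set W := (czconst (q ^ a) * w) ^ (- m).
have shift (d : int) :
    (czconst (q ^ (a + d)) * w) ^ (- m) = czconst (q ^ (- m * d)) * W.
  rewrite addrC expfzDr// czconstM -mulrA expfzMl -/W -czconstX.
  by rewrite exprz_exp [d * _]mulrC.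
rewrite !shift !mulrA -!czconstM -!mulrDl -!czconstD; congr (czconst _ * _).
by rewrite mulr1 mulrN1 opprK; ring.
Qed.

Lemma A_PB_unit (k : 'I_n.+1) (u : Defs.ratz R) :
  A_PB logq k u \is a GRing.unit.
Proof. by rewrite /A_PB vertexE; apply: lin_exp_unit pchar_ratz _. Qed.

(** One step of the recursions defining the letters; the three parts of the
    alphabet obey this same rule at consecutive positions. *)
Lemma letter_step (s : nat) (a : int) : (s < 2 * n.+1)%N ->
  letter folded_Y s.+1 a = letter folded_Y s a *
   (A_PB logq (lab n (minn s.+1 (2 * n.+1 - s)))
     (czconst (q ^ (- s.+1%:Z)) * (czconst (q ^ a) * w)))^-1.
Proof.
move=> lt_s; have := @A_PB_folded_Y s.+1 (a - s.+1%:Z).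
rewrite subSS czconst_shift /= => /(_ lt_s).
set A := A_PB _ _ _; rewrite /letter.
rewrite (_ : a - s.+1%:Z + 1 = a - s%:Z); last by lia.
rewrite (_ : a - s%:Z - 1 = a - s.+1%:Z); last by lia.
set b := a - s.+1%:Z => AU.
apply: div_of_mulE AU; first exact: A_PB_unit; exact: folded_Y_unit.
Qed.

Lemma Lam_pos_letter (k : nat) (a : int) : (k < n.+1)%N ->
  Lam_pos q logq k.+1 (czconst (q ^ a) * w) = letter folded_Y k a.
Proof.
elim: k => [|k IH] lt_k.
  rewrite /= /letter folded_Y0 divr1 subr0 /Y_PB /folded_Y.
  have -> : dual_coef 1 = (fun m j => invmx (Bmx n q m) (lab n 1) j);
    last by [].
  apply/funext => m; apply/funext => j.
  rewrite /dual_coef /folded.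
  by rewrite (minn_idPl _).
rewrite letter_step; last by lia.
rewrite (minn_idPl _); last by lia.
rewrite -IH; last exact: ltnW.
reflexivity.
Qed.

Lemma Lam_zero_letter (a : int) :
  Lam_zero q logq (czconst (q ^ a) * w) = letter folded_Y n.+1 a.
Proof.
rewrite letter_step; last by lia.
rewrite (_ : minn _ _ = n.+1); last by lia.
rewrite -Lam_pos_letter; last by [].
reflexivity.
Qed.

Lemma Lam_bar_letter (d : nat) (a : int) : (d < n.+1)%N ->
  Lam_bar_rec q logq d (czconst (q ^ a) * w) = letter folded_Y (n.+2 + d) a.
Proof.
elim: d => [|d IH] lt_d.
  rewrite addn0 letter_step; last by lia.
  rewrite (_ : minn _ _ = n.+1); last by lia.
  rewrite -Lam_zero_letter (_ : - n.+2%:Z = - n.+1%:Z - 1); last by lia.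
  reflexivity.
rewrite addnS letter_step; last by lia.
rewrite (_ : minn _ _ = n.+1 - d.+1)%N; last by lia.
rewrite -IH; last exact: ltnW.
rewrite (_ : - (n.+2 + d).+1%:Z = - 2 * n.+1%:Z + (n.+1 - d.+1)%N%:Z - 1);
  last by lia.
reflexivity.
Qed.

Lemma Lam_letter (s : 'I_(2 * n.+1).+1) (a : int) :
  Lam q logq s (czconst (q ^ a) * w) = letter folded_Y s a.
Proof.
have lt_s := ltn_ord s; rewrite /Lam; case: ltngtP => [lt_sn|gt_sn|->].
- exact: Lam_pos_letter.
- rewrite /Lam_bar Lam_bar_letter; last by lia.
  by rewrite (_ : (n.+2 + _)%N = s); last by lia.
- exact: Lam_zero_letter.
Qed.

End Vertex.

Theorem corollary3p6 (R : realType) (n : nat) (q logq : R[i])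
  (hq0 : q != 0) (hq1 : `|q| < 1) (hlogq : cexp logq = q)
  (i : nat) (hi : (i <= n.+1)%N) :
  T_PB n q logq (2 * n.+1 + 1 - i) zvar = T_PB n q logq i zvar.
Proof.
have T_letter k : T_PB n q logq k zvar =
    \sum_(Om : {set 'I_(2 * n.+1).+1} | #|Om| == k)
      \prod_(p < k) letter (@folded_Y R n q logq zvar)
        (nth ord0 (enum Om) p) (2 * p%:Z - k%:Z + 1).
  by apply: eq_bigr => Om _; apply: eq_bigr => p _; apply: Lam_letter.
rewrite !T_letter addn1; apply: letter_sum_duality.
- exact: folded_Y_unit.
- exact: folded_Y0.
- exact: folded_Y_sym.
- lia.
Qed.
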